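(* Let $d\ge 1$, $q\in\mathbb{N}$ with $q\ge1$, $\lambda>0$, $\mathcal{A}=d\{0,\pm1,\dots,\pm q\}$ and $A\in\mathbb{R}^{m\times n}$. Let $\widetilde{x}\in\mathcal{A}^n$ be a $k$-sparse signal with support $S$, let $\delta\in\mathbb{R}^n$ (signal noise), $\epsilon\in\mathbb{R}^m$ (measurement noise), and let $y=A(\widetilde{x}+\delta)+\epsilon$. Let $x^\star$ be a global minimum point over $[-qd,qd]^n$ of $$\mathcal{H}(x)=\frac12\|y-Ax\|_2^2+\lambda\sum_{i=1}^n\beta_i(x_i)\,|x_i|-\frac{\lambda}{2}\|x\|_2^2,\qquad \beta_i(x_i)=\min\{\alpha\in\mathcal{A}:\ |x_i|\le\alpha\}.$$ For each $i\in S$ let $p_i\in\mathbb{R}$ be such that $$\beta_i(x^\star_i)\,x^\star_i=\beta_i(\widetilde{x}_i)\,\widetilde{x}_i-p_i\,(x^\star_i-\widetilde{x}_i),$$ and let $p=\max_{i\in S}|p_i|$, with $p>0$. If $A$ satisfies the $\ell_2$-robust null space property (RNSP) of order $k$ with parameters $\tau>0$ and $\rho\in(0,p^{-1})$, then $$\|x^\star-\widetilde{x}\|_1\le C_1\|A\delta+\epsilon\|_2^2+C_2\left(2\|A\delta+\epsilon\|_2+qd\sqrt{\lambda k}\right),$$ where $$C_1=\frac{1+\rho}{\lambda(1-p\rho)},\qquad C_2=\frac{p+1-p\rho}{1-p\rho}\,\tau\sqrt{k}.$$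
   Context: A vector is $k$-sparse if its support $S$ (set of indices of non-zero components) satisfies $|S|=k$. For $v\in\mathbb{R}^n$ and $S\subseteq\{1,\dots,n\}$, $v_S$ is the restriction of $v$ to the components in $S$, and $S^c$ is the complement of $S$. RNSP: a matrix $A\in\mathbb{R}^{m\times n}$ satisfies the $\ell_2$-robust null space property of order $k$ with parameters $\rho\in(0,1)$, $\tau>0$ if $$\|v_S\|_2\le \frac{\rho}{\sqrt{k}}\|v_{S^c}\|_1+\tau\|Av\|_2$$ for any $v\in\mathbb{R}^n$ and any $S\subset\{1,\dots,n\}$ with $|S|\le k$. (In particular $\rho\in(0,1)$ as part of the RNSP.) *)

(* Defs.v *)
From HB Require Import structures.
From mathcomp Require Import all_boot all_order all_algebra.
From mathcomp Require Import reals zify.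

Set Implicit Arguments.
Unset Strict Implicit.
Unset Printing Implicit Defensive.

Import Order.TTheory GRing.Theory Num.Theory.
Local Open Scope ring_scope.

Definition l1norm (R : realType) (n : nat) (v : 'cV[R]_n) : R :=
  \sum_(i < n) `|v i 0|.

Definition l2norm (R : realType) (n : nat) (v : 'cV[R]_n) : R :=
  Num.sqrt (\sum_(i < n) v i 0 ^+ 2).

Definition supp (R : realType) (n : nat) (v : 'cV[R]_n) : {set 'I_n} :=
  [set i | v i 0 != 0].

Definition sparse (R : realType) (n k : nat) (v : 'cV[R]_n) : Prop :=
  #|supp v| = k.

(* v_S, kept in R^n by filling the components outside S with zeros; this
   changes neither the l1 nor the l2 norm. *)
Definition restr (R : realType) (n : nat) (S : {set 'I_n}) (v : 'cV[R]_n) :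
  'cV[R]_n := \col_i (if i \in S then v i 0 else 0).

Definition RNSP (R : realType) (m n : nat) (A : 'M[R]_(m, n)) (k : nat)
    (rho tau : R) : Prop :=
  [/\ 0 < rho < 1, 0 < tau &
      forall (v : 'cV[R]_n) (S : {set 'I_n}), (#|S| <= k)%N ->
        l2norm (restr S v) <=
          rho / Num.sqrt k%:R * l1norm (restr (~: S) v)
          + tau * l2norm (A *m v)].

(* The list d * (-q), ..., d * (-1), 0, d, ..., d * q. *)
Definition alphabet (R : realType) (d : R) (q : nat) : seq R :=
  [seq d * (j%:R - q%:R) | j <- iota 0 (q.*2).+1].

(* min {a in alphabet | |x| <= a}. The set is nonempty exactly when
   |x| <= q d (for d >= 0), and the default d q, the largest letter, does not
   affect the minimum then; see betaP. *)
Definition beta (R : realType) (d : R) (q : nat) (x : R) : R :=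
  \big[Num.min/d * q%:R]_(a <- alphabet d q | `|x| <= a) a.

Definition in_box (R : realType) (n : nat) (r : R) (x : 'cV[R]_n) : Prop :=
  forall i, - r <= x i 0 <= r.

Definition objective (R : realType) (m n : nat) (d : R) (q : nat) (lambda : R)
    (A : 'M[R]_(m, n)) (y : 'cV[R]_m) (x : 'cV[R]_n) : R :=
  1 / 2 * l2norm (y - A *m x) ^+ 2
  + lambda * (\sum_(i < n) beta d q (x i 0) * `|x i 0|)
  - lambda / 2 * l2norm x ^+ 2.

Definition global_min_on (R : realType) (n : nat) (D : 'cV[R]_n -> Prop)
    (H : 'cV[R]_n -> R) (x : 'cV[R]_n) : Prop :=
  D x /\ forall z, D z -> H x <= H z.

Lemma alphabetP (R : realType) (d : R) (q : nat) (a : R) :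
  reflect (exists2 j : int, (`|j| <= q)%N & a = d * j%:~R)
          (a \in alphabet d q).
Proof.
apply: (iffP mapP) => [[j]|[j jq ->]].
  rewrite mem_iota add0n ltnS => /andP[_ jq] ->.
  exists (j%:Z - q%:Z); last by rewrite intrB.
  lia.
exists (absz (j + q%:Z)).
  by rewrite mem_iota; lia.
congr (_ * _).
have -> : j = (absz (j + q%:Z))%:Z - q%:Z by lia.
rewrite intrB; congr (_%:R - _); lia.
Qed.

Lemma betaP (R : realType) (d : R) (q : nat) (x : R) :
  `|x| <= d * q%:R ->
  [/\ beta d q x \in alphabet d q, `|x| <= beta d q x &
      forall a, a \in alphabet d q -> `|x| <= a -> beta d q x <= a].
Proof.
move=> xq.
have dq : d * q%:R \in alphabet d q.
  by apply/alphabetP; exists q%:Z => //; rewrite absz_nat.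
have /andP[bA xb] : (beta d q x \in alphabet d q) && (`|x| <= beta d q x).
  rewrite /beta big_seq_cond.
  apply: (big_ind (fun b => (b \in alphabet d q) && (`|x| <= b))) => //.
    by rewrite dq.
  by move=> b c hb hc; rewrite minEle; case: ifP.
split=> // a aA xa.
rewrite /beta; elim: (alphabet d q) aA => //= b s IH.
rewrite inE big_cons => /orP[/eqP <-|/IH h]; first by rewrite xa ge_min lexx.
by case: ifP => // _; rewrite ge_min h orbT.
Qed.

(* Main.v *)
Require Import Defs.
From mathcomp Require Import all_boot all_order all_algebra.
From mathcomp Require Import reals.
From mathcomp Require Import ring lra zify.
Set Implicit Arguments.
Unset Strict Implicit.
Unset Printing Implicit Defensive.

Import Order.TTheory GRing.Theory Num.Theory.
Local Open Scope ring_scope.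

(** Write v = xs - xt for the error, S for the support of xt, w = A delta + eps
    for the total noise, and h x = beta x * x. Put a = |v_(S^c)|_1,
    b = |v_S|_1, M = d q sqrt k. Two facts tie xs to xt: the objective is
    not larger at xs, and v obeys the null space property.

    Objective. Since beta x >= |x|, with equality at letters, the penalty
    beta |x| - x^2/2 is at least beta |x| / 2, with equality at letters. So
    H xs <= H xt gives (minimality_gap)

      |w - Av|^2 + lambda sum_i beta(xs_i)|xs_i|
        <= |w|^2 + lambda sum_i beta(xt_i)|xt_i|.

    Off S the left sum dominates d a >= a while the right one vanishes. On S,
    the difference of the two terms at i is at most |h(xt_i) - h(xs_i)|
    = |p_i v_i| <= p |v_i|, and also at most (q d)^2. With
    |w - Av| >= | |w| - |Av| | this bounds lambda a by
    2 |Av| |w| - |Av|^2 plus either lambda p b or lambda M^2.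

    Null space property. By Cauchy-Schwarz on S, b <= rho a + tau sqrt k |Av|.

    What remains is a statement about real numbers, error_budget. Eliminating
    b from the first bound and using |Av| <= 2|w| + sqrt lambda M (the second
    bound and a >= 0) would produce the constant p + 1 in C2. The sharper
    p + 1 - p rho is obtained by keeping the square (|Av| - |w|)^2, which
    compensates when tau is small compared with M, and by using the second
    bound, which does not involve p, when tau is large. The two regimes
    overlap only because p >= 1, and this comes from the weights: h expands
    distances by at least d >= 1 (beta_mul_expansive), so that |p_i| >= 1
    as soon as v_i <> 0 for some i in S; if v vanishes on S then b = 0 and
    the first bound suffices. *)

(** * Finite sums and norms *)

Lemma sum_cauchy_schwarz (R : realType) (I : finType) (P : pred I)
    (f g : I -> R) :
  \sum_(i | P i) f i * g i
    <= Num.sqrt (\sum_(i | P i) f i ^+ 2) * Num.sqrt (\sum_(i | P i) g i ^+ 2).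
Proof.
have F0 : 0 <= \sum_(i | P i) f i ^+ 2.
  by apply: sumr_ge0 => i _; exact: sqr_ge0.
rewrite -sqrtrM //; apply: le_trans (ler_norm _) _; rewrite -sqrtr_sqr.
apply: ler_wsqrtr; rewrite -subr_ge0.
(* Lagrange's identity: the defect is a sum of squares over pairs. *)
have lagrange : \sum_(i | P i) \sum_(j | P j) (f i * g j - f j * g i) ^+ 2
   = 2 * ((\sum_(i | P i) f i ^+ 2) * (\sum_(i | P i) g i ^+ 2)
          - (\sum_(i | P i) f i * g i) ^+ 2).
  transitivity (\sum_(i | P i) (f i ^+ 2 * (\sum_(j | P j) g j ^+ 2)
     + g i ^+ 2 * (\sum_(j | P j) f j ^+ 2)
     - 2 * (f i * g i) * (\sum_(j | P j) f j * g j))).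
    apply: eq_bigr => i _; rewrite !mulr_sumr -big_split -sumrB /=.
    by apply: eq_bigr => j _; ring.
  rewrite sumrB big_split /= -!mulr_suml -mulr_sumr; ring.
have : 0 <= \sum_(i | P i) \sum_(j | P j) (f i * g j - f j * g i) ^+ 2.
  by do 2![apply: sumr_ge0 => ? _]; exact: sqr_ge0.
by rewrite lagrange pmulr_rge0.
Qed.

Section Norms.
Variables (R : realType) (n : nat).
Implicit Types (v w : 'cV[R]_n) (S : {set 'I_n}).

Lemma l2norm_ge0 v : 0 <= l2norm v.
Proof. exact: sqrtr_ge0. Qed.

Lemma sqr_l2norm v : l2norm v ^+ 2 = \sum_i v i 0 ^+ 2.
Proof. by rewrite sqr_sqrtr //; apply: sumr_ge0 => i _; exact: sqr_ge0. Qed.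

(** The reverse triangle inequality, squared so that the sign of the
    difference of norms is immaterial. *)
Lemma sqr_l2norm_dist v w : (l2norm v - l2norm w) ^+ 2 <= l2norm (v - w) ^+ 2.
Proof.
have -> : l2norm (v - w) ^+ 2
    = l2norm v ^+ 2 - 2 * (\sum_i v i 0 * w i 0) + l2norm w ^+ 2.
  rewrite !sqr_l2norm mulr_sumr -sumrB -big_split /=.
  by apply: eq_bigr => i _; rewrite !mxE; ring.
have := @sum_cauchy_schwarz R 'I_n xpredT (fun i => v i 0) (fun i => w i 0).
rewrite -!/(l2norm _); nra.
Qed.

Lemma l1norm_restr S v : l1norm (restr S v) = \sum_(i in S) `|v i 0|.
Proof.
rewrite /l1norm [RHS]big_mkcond; apply: eq_bigr => i _.
by rewrite mxE; case: ifP => _; rewrite ?normr0.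
Qed.

Lemma l1norm_split S v :
  l1norm v = l1norm (restr S v) + l1norm (restr (~: S) v).
Proof.
rewrite !l1norm_restr /l1norm (bigID (mem S)) /=; congr (_ + _).
by apply: eq_bigl => i; rewrite inE.
Qed.

Lemma l1norm_ge0 v : 0 <= l1norm v.
Proof. exact: sumr_ge0. Qed.

Lemma l1_restr_le_l2 S v :
  l1norm (restr S v) <= Num.sqrt #|S|%:R * l2norm (restr S v).
Proof.
have := @sum_cauchy_schwarz R 'I_n (fun i => i \in S) (fun=> 1)
  (fun i => `|v i 0|).
under eq_bigr do rewrite mul1r.
under [X in Num.sqrt X * _]eq_bigr do rewrite expr1n.
rewrite sumr_const l1norm_restr; congr (_ <= _ * Num.sqrt _).
rewrite big_mkcond; apply: eq_bigr => i _; rewrite mxE.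
by case: ifP => _; [rewrite real_normK ?num_real | rewrite expr0n].
Qed.

End Norms.

(** * The weights *)

Section Weights.
Variables (R : realType) (d : R) (q : nat).
Hypothesis d_gt0 : 0 < d.
Implicit Types (x y : R).

Lemma beta_mono x y :
  `|x| <= `|y| -> `|y| <= d * q%:R -> beta d q x <= beta d q y.
Proof.
move=> xy yq; have [bA yb _] := betaP yq.
by have [_ _ ->] := betaP (le_trans xy yq); last exact: le_trans yb.
Qed.

Lemma le_d_beta x : x != 0 -> `|x| <= d * q%:R -> d <= beta d q x.
Proof.
move=> x0 xq; have [/alphabetP[j _ ->] xb _] := betaP xq.
have : 0 < d * j%:~R by apply: lt_le_trans xb; rewrite normr_gt0.
rewrite pmulr_rgt0 // ltr0z => j0; by rewrite ler_peMr ?ler1z ?(ltW d_gt0).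
Qed.

Lemma letter_le x : x \in alphabet d q -> `|x| <= d * q%:R.
Proof.
case/alphabetP => j jq ->.
by rewrite normrM gtr0_norm // ler_pM2l // -intr_norm -abszE ler_nat.
Qed.

Lemma beta_letter x : x \in alphabet d q -> beta d q x = `|x|.
Proof.
move=> xA; have [_ xb bmin] := betaP (letter_le xA).
apply/eqP; rewrite eq_le xb andbT bmin //.
case/alphabetP: xA => j jq ->; apply/alphabetP; exists `|j|; first lia.
by rewrite normrM gtr0_norm // intr_norm.
Qed.

Lemma d_norm_le_beta x :
  `|x| <= d * q%:R -> d * `|x| <= beta d q x * `|x|.
Proof.
have [->|x0 xq] := eqVneq x 0; first by rewrite normr0 !mulr0.
by rewrite ler_wpM2r // le_d_beta.
Qed.

Lemma norm_beta_mul x :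
  `|x| <= d * q%:R -> `|beta d q x * x| = beta d q x * `|x|.
Proof.
move=> xq; have [_ xb _] := betaP xq.
by rewrite normrM (ger0_norm (le_trans _ xb)).
Qed.

Lemma betaN x : beta d q (- x) = beta d q x.
Proof. by rewrite /beta normrN. Qed.

(** For points on the same side of 0, monotonicity of beta in the absolute value
    makes the slope of the chord at least the weight of the farther one, which
    is at least d; for opposite signs the two contributions d |x| and d |y|
    add up. Oddness of the map reduces everything to 0 <= x. *)
Lemma beta_mul_expansive x y : `|x| <= d * q%:R -> `|y| <= d * q%:R ->
  d * `|x - y| <= `|beta d q x * x - beta d q y * y|.
Proof.
wlog xy : x y / y <= x => [th|] xq yq.
  have [|/ltW xy] := leP y x; first by move/th; apply.
  by rewrite distrC [leRHS]distrC th.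
apply: le_trans (ler_norm _); rewrite ger0_norm ?subr_ge0 //.
wlog x0 : x y xy xq yq / 0 <= x => [th|].
  have [|x0] := leP 0 x; first exact: th.
  have := th (- y) (- x); rewrite !normrN !betaN lerN2 => /(_ xy yq xq).
  by rewrite oppr_ge0 !mulrN !opprK; move=> /(_ ltac:(lra)); lra.
have dx := d_norm_le_beta xq; rewrite ger0_norm // in dx.
have [y0|y0] := leP 0 y; last first.
  have := d_norm_le_beta yq; rewrite ltr0_norm //; lra.
have [x_eq0|x_neq0] := eqVneq x 0.
  by have -> : y = x by [lra]; lra.
have := @beta_mono y x; rewrite !ger0_norm // -[X in X <= d * _](ger0_norm x0).
move=> /(_ xy xq) byx; have := le_d_beta x_neq0 xq => dbx; nra.
Qed.

End Weights.

(** * Combining the bounds *)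

(** In the application a and b are the l1 errors off and on the support,
    u and om the norms of Av and of the noise divided by sqrt lambda, and
    s = tau sqrt k sqrt lambda. Put c = p + 1 - p rho and r = u - om.

    If p s <= (1 + rho) M, add 1 + rho times the first bound and 1 + p times
    the second one. What is left to show is that the sum of the quadratic
    (1 + rho) r^2 - (1 + p) s r + c s M and of s om (p + 1 - 2 p rho) is
    nonnegative. The latter is so because p rho < 1 <= p, and the former
    because its discriminant is nonpositive: (1 + p)^2 s <= 4 p^2 s
    <= 4 c (p s) <= 4 c (1 + rho) M, using 1 <= p <= c.

    Otherwise (1 + rho) M^2 <= p s M, so the contribution of M^2 in the third
    bound is paid by the term p s M of the target, and u <= 2 om + M pays for
    the rest. *)
Lemma error_budget (R : realType) (a b p rho s M u om : R) :
  0 <= a -> 0 < p -> 0 < rho -> p * rho < 1 ->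
  0 <= s -> 0 <= M -> 0 <= u -> 0 <= om ->
  b = 0 \/ 1 <= p ->
  a <= 2 * u * om - u ^+ 2 + p * b ->
  b <= rho * a + s * u ->
  a <= 2 * u * om - u ^+ 2 + M ^+ 2 ->
  (1 - p * rho) * (a + b)
    <= (1 + rho) * om ^+ 2 + (p + 1 - p * rho) * s * (2 * om + M).
Proof.
move=> a0 p0 rho0 prho1 s0 M0 u0 om0 hp h1 h2 h3.
have prho0 : 0 < p * rho by exact: mulr_gt0.
have cs0 : 0 <= (p + 1 - p * rho) * s by apply: mulr_ge0 => //; lra.
case: hp => [b0|p1].
  have : 0 <= (p + 1 - p * rho) * s * (2 * om + M).
    by apply: mulr_ge0 => //; lra.
  have : a <= om ^+ 2 by rewrite b0 in h1; have := sqr_ge0 (u - om); nra.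
  have := mulr_ge0 (ltW prho0) a0; have := mulr_ge0 (ltW rho0) (sqr_ge0 om).
  rewrite b0; nra.
have [psM|psM] := leP (p * s) ((1 + rho) * M).
  have : (1 - p * rho) * (a + b)
      <= (1 + rho) * (2 * u * om - u ^+ 2) + (1 + p) * (s * u).
    have -> : (1 - p * rho) * (a + b)
        = (1 + rho) * (a - p * b) + (1 + p) * (b - rho * a) by ring.
    by apply: lerD; rewrite ler_pM2l ?lerBlDr ?lerBlDl //; lra.
  have disc : ((1 + p) * s) ^+ 2
      <= 4 * ((1 + rho) * M) * ((p + 1 - p * rho) * s).
    apply: (@le_trans _ _ (4 * (p * s) * ((p + 1 - p * rho) * s))).
      have : (1 + p) ^+ 2 <= 4 * p * (p + 1 - p * rho).
        have : 0 <= p * (1 - p * rho) by apply: mulr_ge0; lra.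
        (* 4 p^2 - (1 + p)^2 factors as (p - 1) (3 p + 1). *)
        have : 0 <= (p - 1) * (3 * p + 1) by apply: mulr_ge0; lra.
        lra.
      move/(ler_wpM2r (sqr_ge0 s)).
      rewrite [leLHS]mulrC -exprMn [X in X ^+ _]mulrC => /le_trans; apply.
      lra.
    by rewrite ler_wpM2r // ler_pM2l //; lra.
  suff : 0 <= (1 + rho) * (u - om) ^+ 2 - (1 + p) * s * (u - om)
              + (p + 1 - p * rho) * s * M + s * om * (p + 1 - 2 * (p * rho)).
    by lra.
  apply: addr_ge0; last by apply: mulr_ge0; [exact: mulr_ge0 | lra].
  (* Completing the square needs the factor 4 times the leading coefficient. *)
  rewrite -(@pmulr_rge0 _ (4 * (1 + rho))); last lra.
  have := sqr_ge0 (2 * (1 + rho) * (u - om) - (1 + p) * s); lra.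
have uB : u <= 2 * om + M.
  have : (u - om) ^+ 2 <= (om + M) ^+ 2.
    by have := mulr_ge0 om0 M0; lra.
  move=> h; rewrite leNgt; apply/negP => uB.
  have : (om + M) ^+ 2 < (u - om) ^+ 2 by rewrite ltr_pXn2r ?nnegrE //; lra.
  lra.
have su : s * u <= s * (2 * om + M) by rewrite ler_wpM2l.
have aB : (1 + rho) * a <= (1 + rho) * (om ^+ 2 + M ^+ 2).
  by rewrite ler_pM2l; [have := sqr_ge0 (u - om); lra | lra].
have MM : (1 + rho) * M * M <= p * s * M by rewrite ler_wpM2r // ltW.
have D0 : 0 <= p * rho * ((1 + rho) * (om ^+ 2 + M ^+ 2)).
  apply: mulr_ge0; first exact: ltW.
  by apply: mulr_ge0; [lra | rewrite addr_ge0 ?sqr_ge0].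
have : (1 - p * rho) * (a + b) <=
   (1 - p * rho) * ((1 + rho) * (om ^+ 2 + M ^+ 2) + s * (2 * om + M)).
  by rewrite ler_pM2l; lra.
have : 0 <= p * s * om by rewrite !mulr_ge0 ?(ltW p0).
lra.
Qed.

(** * Consequences of minimality *)

Section Minimizer.
Variables (R : realType) (m n q : nat) (d lambda : R).
Variables (A : 'M[R]_(m, n)) (xt delta xs : 'cV[R]_n) (eps y : 'cV[R]_m).
Hypotheses (d_gt0 : 0 < d) (lambda_gt0 : 0 < lambda).
Hypothesis xtA : forall i, xt i 0 \in alphabet d q.
Hypothesis ymeas : y = A *m (xt + delta) + eps.
Hypothesis xs_min :
  global_min_on (in_box (d * q%:R)) (objective d q lambda A y) xs.

Let residue_at x : y - A *m x = A *m delta + eps - A *m (x - xt).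
Proof.
by rewrite ymeas !mulmxDr mulmxN; apply/matrixP => i j; rewrite !mxE; ring.
Qed.

Lemma minimizer_le i : `|xs i 0| <= d * q%:R.
Proof. by rewrite ler_norml; case: xs_min => /(_ i). Qed.

(** At the letters xt_i the weight is |xt_i|, so the penalty there is exactly
    half of beta |xt_i|; at xs it is at least half of beta |xs_i|. *)
Lemma minimality_gap :
  l2norm (A *m delta + eps - A *m (xs - xt)) ^+ 2
    + lambda * (\sum_i beta d q (xs i 0) * `|xs i 0|)
  <= l2norm (A *m delta + eps) ^+ 2
     + lambda * (\sum_i beta d q (xt i 0) * `|xt i 0|).
Proof.
have xt_box : in_box (d * q%:R) xt.
  by move=> i; rewrite -ler_norml letter_le.
have := xs_min.2 _ xt_box.
rewrite /objective !residue_at subrr mulmx0 subr0.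
have Ext : l2norm xt ^+ 2 = \sum_i beta d q (xt i 0) * `|xt i 0|.
  rewrite sqr_l2norm; apply: eq_bigr => i _.
  by rewrite beta_letter // -expr2 real_normK ?num_real.
have : l2norm xs ^+ 2 <= \sum_i beta d q (xs i 0) * `|xs i 0|.
  rewrite sqr_l2norm; apply: ler_sum => i _.
  rewrite -real_normK ?num_real // expr2 ler_wpM2r //.
  by have [_ ->] := betaP (minimizer_le i).
rewrite Ext -(ler_pM2l lambda_gt0); lra.
Qed.

End Minimizer.

(** * The recovery bound *)

Theorem theorem4 (R : realType) (m n k q : nat) (d lambda : R)
    (A : 'M[R]_(m, n)) (xt delta xs : 'cV[R]_n) (eps y : 'cV[R]_m)
    (pc : 'I_n -> R) (p rho tau : R) :
  1 <= d -> (1 <= q)%N -> 0 < lambda ->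
  (forall i, xt i 0 \in alphabet d q) ->
  sparse k xt ->
  y = A *m (xt + delta) + eps ->
  global_min_on (in_box (d * q%:R)) (objective d q lambda A y) xs ->
  (forall i, i \in supp xt ->
     beta d q (xs i 0) * xs i 0
     = beta d q (xt i 0) * xt i 0 - pc i * (xs i 0 - xt i 0)) ->
  p = \big[Num.max/0]_(i in supp xt) `|pc i| ->
  0 < p ->
  RNSP A k rho tau ->
  0 < rho < p^-1 ->
  let C1 := (1 + rho) / (lambda * (1 - p * rho)) in
  let C2 := (p + 1 - p * rho) / (1 - p * rho) * tau * Num.sqrt k%:R in
  l1norm (xs - xt)
    <= C1 * l2norm (A *m delta + eps) ^+ 2
       + C2 * (2 * l2norm (A *m delta + eps)
               + d * q%:R * Num.sqrt (lambda * k%:R)).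
Proof.
move=> d1 _ lam0 xtA xtk ymeas xsmin pcE pE p0 [_ tau0 rnsp] /andP[rho0 rhop].
lazy zeta.
have d0 : 0 < d by lra.
have prho1 : p * rho < 1 by rewrite mulrC -ltr_pdivlMr // div1r.
set S := supp xt; set v := xs - xt; set w := A *m delta + eps.
have sizeS : #|S| = k := xtk.
set a := l1norm (restr (~: S) v); set b := l1norm (restr S v).
set L := Num.sqrt lambda; have L0 : 0 < L by rewrite sqrtr_gt0.
have LL : L ^+ 2 = lambda by rewrite sqr_sqrtr // ltW.
set K := Num.sqrt k%:R; have KK : K ^+ 2 = k%:R by rewrite sqr_sqrtr.
have K0 : 0 <= K by exact: sqrtr_ge0.
have box i := minimizer_le xsmin i.
have vE i : v i 0 = xs i 0 - xt i 0 by rewrite !mxE.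
have pcP i : i \in S ->
    pc i * v i 0 = beta d q (xt i 0) * xt i 0 - beta d q (xs i 0) * xs i 0.
  by move=> iS; rewrite pcE // vE; ring.
have pcp i : i \in S -> `|pc i| <= p.
  by move=> iS; rewrite pE; apply: le_bigmax_cond.
have xt0 i : i \notin S -> xt i 0 = 0 by rewrite inE negbK => /eqP.
have off_support : a <= \sum_(i | i \notin S) beta d q (xs i 0) * `|xs i 0|.
  rewrite /a l1norm_restr (eq_bigl (fun i => i \notin S)) => [|i].
    2: by rewrite inE.
  apply: ler_sum => i /xt0 xti; rewrite vE xti subr0.
  apply: le_trans (d_norm_le_beta d0 (box i)).
  by rewrite ler_peMl.
have gap : (l2norm w - l2norm (A *m v)) ^+ 2 + lambda * a <= l2norm w ^+ 2
    + lambda * (\sum_(i in S) (beta d q (xt i 0) * `|xt i 0|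
                               - beta d q (xs i 0) * `|xs i 0|)).
  have := minimality_gap d0 lam0 xtA ymeas xsmin; rewrite -/w -/v.
  have := sqr_l2norm_dist w (A *m v).
  rewrite sumrB (bigID (mem S)) /=.
  rewrite [X in _ -> _ <= _ + _ * X -> _](bigID (mem S)) /=.
  rewrite [X in _ -> _ <= _ + _ * (_ + X) -> _]big1 ?addr0; last first.
    by move=> i /xt0 ->; rewrite normr0 mulr0.
  have := ler_wpM2l (ltW lam0) off_support.
  lra.
have on_support_p : \sum_(i in S) (beta d q (xt i 0) * `|xt i 0|
     - beta d q (xs i 0) * `|xs i 0|) <= p * b.
  rewrite /b l1norm_restr mulr_sumr; apply: ler_sum => i iS.
  apply: (@le_trans _ _ `|pc i * v i 0|); last by rewrite normrM ler_wpM2r ?pcp.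
  rewrite pcP // -(norm_beta_mul (box i)).
  by rewrite -(norm_beta_mul (letter_le d0 (xtA i))) lerB_dist.
have on_support_M : \sum_(i in S) (beta d q (xt i 0) * `|xt i 0|
     - beta d q (xs i 0) * `|xs i 0|) <= (d * q%:R * K) ^+ 2.
  have -> : (d * q%:R * K) ^+ 2 = \sum_(i in S) (d * q%:R) ^+ 2.
    by rewrite sumr_const exprMn KK sizeS -[RHS]mulr_natr.
  apply: ler_sum => i _.
  rewrite beta_letter // -expr2 -(norm_beta_mul (box i)).
  have : `|xt i 0| ^+ 2 <= (d * q%:R) ^+ 2.
    by rewrite lerXn2r ?nnegrE ?letter_le // mulr_ge0 // ltW.
  by have := normr_ge0 (beta d q (xs i 0) * xs i 0); lra.
have null_space : b <= rho * a + tau * K * l2norm (A *m v).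
  apply: le_trans (l1_restr_le_l2 S v) _; rewrite sizeS -/K.
  have := rnsp v S; rewrite sizeS leqnn -/K -/a => /(_ isT) /(ler_wpM2l K0).
  move=> /le_trans; apply; rewrite mulrDr lerD //; last first.
    by rewrite mulrA [K * _]mulrC.
  (* For k = 0 the quotient rho / sqrt k is 0, and only the bound
     sqrt k * (rho / sqrt k) <= rho survives. *)
  have [->|Kn0] := eqVneq K 0; last by rewrite mulrA mulrCA mulfV // mulr1.
  by rewrite mul0r mulr_ge0 ?l1norm_ge0 // ltW.
have hp : b = 0 \/ 1 <= p.
  have [/exists_inP[i iS vi]|] := boolP [exists i in S, v i 0 != 0].
    right; apply: le_trans (pcp i iS); apply: le_trans d1 _.
    rewrite -(ler_pM2r (_ : 0 < `|v i 0|)) ?normr_gt0 // -normrM pcP //.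
    by rewrite vE distrC beta_mul_expansive // letter_le.
  rewrite negb_exists_in => /forall_inP v0; left.
  rewrite /b l1norm_restr big1 // => i /v0; rewrite negbK => /eqP->.
  exact: normr0.
have key : (1 - p * rho) * (a + b) <= (1 + rho) * (l2norm w / L) ^+ 2
    + (p + 1 - p * rho) * (tau * K * L) * (2 * (l2norm w / L) + d * q%:R * K).
  (* The bounds are homogeneous: dividing all norms by sqrt lambda turns the
     weight lambda of the penalty into 1. *)
  have sqE : forall z, lambda * (z / L) ^+ 2 = z ^+ 2.
    by move=> z; rewrite -LL; field; lra.
  have prodE : lambda * (2 * (l2norm (A *m v) / L) * (l2norm w / L))
      = 2 * l2norm (A *m v) * l2norm w.
    by rewrite -LL; field; lra.
  apply: (@error_budget _ _ _ _ _ _ _ (l2norm (A *m v) / L)) => //.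
  - exact: l1norm_ge0.
  - by rewrite !mulr_ge0 // ltW.
  - by rewrite !mulr_ge0 // ltW.
  - by rewrite divr_ge0 ?l2norm_ge0 // ltW.
  - by rewrite divr_ge0 ?l2norm_ge0 // ltW.
  - rewrite -(ler_pM2l lam0) !(mulrDr lambda) mulrN sqE prodE.
    by have := ler_wpM2l (ltW lam0) on_support_p; lra.
  - by have -> : tau * K * L * (l2norm (A *m v) / L) = tau * K * l2norm (A *m v)
      by field; lra.
  - rewrite -(ler_pM2l lam0) !(mulrDr lambda) mulrN sqE prodE.
    by have := ler_wpM2l (ltW lam0) on_support_M; lra.
rewrite (l1norm_split S) -/a -/b addrC -(@ler_pM2l _ (1 - p * rho)); last lra.
apply: le_trans key _; rewrite le_eqVlt; apply/orP; left; apply/eqP.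
rewrite sqrtrM ?ltW // -/L -/K -LL.
by field; lra.
Qed.
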